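(* Let $n\geq 1$, $k\geq 2$, and $\sigma\in\{231,312,321\}$. Then the number of permutations $\pi\in\mathcal{S}_n$ such that $\pi,\theta(\pi),\theta^2(\pi),\dots,\theta^k(\pi)$ all avoid $\sigma$ equals $F_{n+1}$, the $(n+1)$-st Fibonacci number.
   Context: $\mathcal{S}_n$ is the symmetric group on $[n]$, permutations in one-line notation $\pi_1\cdots\pi_n$. A permutation avoids a pattern $\tau$ if it has no subsequence order-isomorphic to $\tau$. The standard cycle notation of $\pi$ writes each cycle (fixed points included) with its largest element first and orders cycles by increasing largest element. The fundamental bijection $\theta:\mathcal{S}_n\to\mathcal{S}_n$ maps $\pi$ to the permutation whose one-line notation is obtained by erasing the parentheses of the standard cycle notation of $\pi$; $\theta^k$ denotes its $k$-fold composition. Fibonacci numbers: $F_0=0$, $F_1=F_2=1$, $F_m=F_{m-1}+F_{m-2}$. *)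

(* Defs.v *)
From mathcomp Require Import all_boot all_order all_fingroup.

Set Implicit Arguments.
Unset Strict Implicit.
Unset Printing Implicit Defensive.

(* 'S_n acts on 'I_n = {0, ..., n-1}; letters of words are shifted to 1, ..., n. *)
Definition one_line (n : nat) (s : 'S_n) : seq nat :=
  [seq (s i).+1 | i <- enum 'I_n].

Definition order_iso (t u : seq nat) : bool :=
  (size t == size u) &&
  [forall i : 'I_(size t), forall j : 'I_(size t),
     (nth 0 t i < nth 0 t j) == (nth 0 u i < nth 0 u j)].

(* [mask m w] with [m] a bit vector of the length of [w] runs over all
   subsequences of [w]; see containsP. *)
Definition contains (w tau : seq nat) : bool :=
  [exists m : (size w).-tuple bool, order_iso (mask m w) tau].

Definition avoids (n : nat) (s : 'S_n) (tau : seq nat) : bool :=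
  ~~ contains (one_line s) tau.

Lemma containsP (w tau : seq nat) :
  reflect (exists2 t, subseq t w & order_iso t tau) (contains w tau).
Proof.
apply: (iffP existsP) => [[m Hm]|[t /subseqP[m sz_m ->] Hm]].
  by exists (mask m w) => //; apply: mask_subseq.
have Hs : size m == size w by apply/eqP.
by exists (Tuple Hs).
Qed.

Section Fundamental.

Variables (n : nat) (s : 'S_n).

(* [enum 'I_n] is increasing, hence so is this sequence. *)
Definition cycle_maxima : seq 'I_n :=
  [seq m <- enum 'I_n | [forall j in porbit s m, j <= m]].

(* The cycle (m, s m, s (s m), ...). *)
Definition cycle_from (m : 'I_n) : seq 'I_n := traject s m #|porbit s m|.

Definition standard_cycles : seq (seq 'I_n) := map cycle_from cycle_maxima.

Definition theta_word : seq 'I_n := flatten standard_cycles.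

Lemma mem_theta_word (i : 'I_n) : i \in theta_word.
Proof.
have [m mi mmax] : exists2 m, m \in porbit s i &
    forall j, j \in porbit s i -> j <= m.
  by case: (arg_maxnP (fun j : 'I_n => nat_of_ord j) (porbit_id s i)) => m;
    exists m.
have E : porbit s m = porbit s i by apply/eqP; rewrite eq_porbit_mem.
apply/flatten_mapP; exists m; last first.
  by rewrite /cycle_from -porbit_traject E porbit_id.
rewrite mem_filter mem_enum andbT.
by apply/forall_inP => j; rewrite E; apply: mmax.
Qed.

Lemma theta_word_uniq : uniq theta_word.
Proof.
rewrite /theta_word /standard_cycles.
have : all (fun m : 'I_n => [forall j in porbit s m, j <= m]) cycle_maxima.
  exact: filter_all.
have : uniq cycle_maxima by apply: filter_uniq; apply: enum_uniq.
elim: cycle_maxima => //= m r IH /andP[mr ur] /andP[/forall_inP Hm Hr].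
rewrite cat_uniq uniq_traject_porbit IH // andbT /=.
apply/hasPn => x /flatten_mapP[m' m'r].
rewrite /cycle_from -!porbit_traject => xm'.
apply/negP => xm.
have /forall_inP Hm' := allP Hr _ m'r.
have E : porbit s m = porbit s m'.
  move: xm xm'; rewrite -!eq_porbit_mem => /eqP <-.
  by move/eqP.
have mm' : m = m'.
  apply/val_inj/eqP; rewrite eqn_leq Hm' -?E ?porbit_id //=.
  by rewrite Hm // E porbit_id.
by rewrite mm' m'r in mr.
Qed.

Lemma size_theta_word : size theta_word = n.
Proof.
rewrite -(card_uniqP theta_word_uniq) -[RHS]card_ord.
by apply: eq_card => i; rewrite mem_theta_word.
Qed.

Lemma theta_inj : injective (fun i : 'I_n => nth i theta_word i).
Proof.
move=> i j; rewrite (set_nth_default j) ?size_theta_word // => /eqP.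
by rewrite nth_uniq ?size_theta_word ?theta_word_uniq // => /eqP/val_inj.
Qed.

(* The default value of [nth] is never used: [theta_word] has size [n]. *)
Definition theta : 'S_n := perm theta_inj.

End Fundamental.

Lemma one_line_theta (n : nat) (s : 'S_n) :
  one_line (theta s) = [seq (val i).+1 | i <- theta_word s].
Proof.
apply: (@eq_from_nth _ 0);
  first by rewrite [LHS]size_map [RHS]size_map size_theta_word size_enum_ord.
move=> i; rewrite size_map size_enum_ord => lt_in.
have x0 := Ordinal lt_in.
rewrite [LHS](nth_map x0) ?size_enum_ord // [RHS](nth_map x0) ?size_theta_word //.
by rewrite permE nth_enum_ord // (set_nth_default x0) // size_theta_word.
Qed.

Fixpoint fib (m : nat) : nat :=
  match m with
  | 0 => 0
  | 1 => 1
  | (m'.+1 as m1).+1 => fib m1 + fib m'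
  end.

(* Main.v *)
Require Import Defs.
From mathcomp Require Import all_boot all_order all_fingroup.
From mathcomp Require Import zify.

(** Call [i] near-fixed when [s] fixes it or swaps it with a neighbour.  If all
    points are near-fixed then [theta s = s] and [s] avoids the three patterns,
    and such [s] are counted by the Fibonacci recursion on the last point.
    Conversely, suppose [s], [theta s] and [theta (theta s)] avoid [sigma] and
    some point is not near-fixed.

    For 312 and 231 let [N] be the largest such point; it is the maximum of its
    cycle and [theta s] sends [N] to [z], the preimage of [N] under [s].
    For 312, avoidance in [s] and [theta s] forces [s] to swap [N] with
    [z < N - 1]; then [theta s] sends [N - 1] to [N] to [z], and
    [N, z, N - 1] is a 312 in [theta (theta s)].
    For 231, everything left of [z] is [s]-stable, so [theta s] swaps [N] and
    [z], and any [w] strictly between gives a 231 [w, N, z] in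
    [theta (theta s)].

    For 321 let [M] be the smallest cycle maximum that is not near-fixed and
    [a = s M].  Avoidance in [theta s] puts every [e < a] into an earlier cycle,
    and avoidance in [s] shows that the earlier cycles contain nothing else.
    Hence [theta s] sends [a + 1] to [a] to [M], and [theta (theta s)] contains
    a 321 unless [M = a + 1], in which case [s] swaps [a] and [a + 1]. *)

Set Implicit Arguments.
Unset Strict Implicit.
Unset Printing Implicit Defensive.

(** * Initial segments and the order of ['I_n] *)

Lemma card_ord_lt (n k : nat) : k <= n -> #|[set x : 'I_n | x < k]| = k.
Proof.
move=> le_kn.
have inj : injective (widen_ord le_kn) by move=> x y /(congr1 val) /= /val_inj.
rewrite -[RHS]card_ord -(card_imset _ inj).
apply: eq_card => x; rewrite inE; apply/idP/imsetP => [lt_xk|[y _ ->]] /=.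
  by exists (Ordinal lt_xk) => //; apply: val_inj.
exact: (ltn_ord y).
Qed.

Lemma ltn_ord_trans (n : nat) : transitive (fun x y : 'I_n => x < y).
Proof. by move=> y x z /=; apply: ltn_trans. Qed.

Lemma enum_ord_sorted (n : nat) : sorted (fun x y : 'I_n => x < y) (enum 'I_n).
Proof. by have := iota_ltn_sorted 0 n; rewrite -val_enum_ord sorted_map. Qed.

(** * Occurrences of patterns of length three *)

Section Patterns.

Variables (n : nat) (s : 'S_n).

Lemma subseq_enum_ord3 (i j k : 'I_n) :
  i < j -> j < k -> subseq [:: i; j; k] (enum 'I_n).
Proof.
move=> ij jk.
have -> : [:: i; j; k] = [seq x <- enum 'I_n | x \in [:: i; j; k]];
  last exact: filter_subseq.
apply: (@irr_sorted_eq _ (fun x y : 'I_n => x < y)).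
- exact: ltn_ord_trans.
- by move=> x /=; rewrite ltnn.
- by rewrite /= ij jk.
- apply: sorted_filter; first exact: ltn_ord_trans.
  exact: enum_ord_sorted.
- by move=> x; rewrite mem_filter mem_enum andbT.
Qed.

(** Each comparison is required in both directions because [order_iso] tests every ordered pair of
    positions. *)
Lemma avoids3 (a b c : nat) (i j k : 'I_n) :
  avoids s [:: a; b; c] -> i < j -> j < k ->
  (s i < s j) = (a < b) -> (s j < s i) = (b < a) ->
  (s j < s k) = (b < c) -> (s k < s j) = (c < b) ->
  (s i < s k) = (a < c) -> (s k < s i) = (c < a) -> False.
Proof.
move=> /negP avs ij jk e1 e2 e3 e4 e5 e6; apply: avs; apply/containsP.
exists [seq (s x).+1 | x <- [:: i; j; k]].
  exact/map_subseq/subseq_enum_ord3.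
rewrite /order_iso eqxx /=; apply/forallP => -[x ltx]; apply/forallP => -[y lty].
by case: x y ltx lty => [|[|[|x]]] [|[|[|y]]] //= _ _;
  rewrite ltnS ?e1 ?e2 ?e3 ?e4 ?e5 ?e6 ?ltnn.
Qed.

Lemma avoids231 (i j k : 'I_n) : avoids s [:: 2; 3; 1] ->
  i < j -> j < k -> s i < s j -> s k < s i -> False.
Proof. by move=> av ij jk *; apply: (avoids3 av ij jk); lia. Qed.

Lemma avoids312 (i j k : 'I_n) : avoids s [:: 3; 1; 2] ->
  i < j -> j < k -> s j < s k -> s k < s i -> False.
Proof. by move=> av ij jk *; apply: (avoids3 av ij jk); lia. Qed.

Lemma avoids321 (i j k : 'I_n) : avoids s [:: 3; 2; 1] ->
  i < j -> j < k -> s j < s i -> s k < s j -> False.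
Proof. by move=> av ij jk *; apply: (avoids3 av ij jk); lia. Qed.

(** Only the first and last letters are compared: this is what rules out patterns with [c < a] in
    near-fixed permutations. *)
Lemma contains3 (a b c : nat) :
  contains (one_line s) [:: a; b; c] ->
  exists i j k : 'I_n, [/\ i < j, j < k & (s k < s i) = (c < a)].
Proof.
case/containsP => t /subseqP[m _ ->].
rewrite /one_line -map_mask.
have : sorted (fun x y : 'I_n => x < y) (mask m (enum 'I_n)).
  apply: sorted_mask; first exact: ltn_ord_trans.
  exact: enum_ord_sorted.
case: (mask m _) => [|i [|j [|k [|l r]]]] //= /and3P[ij jk _].
case/andP=> _ /forallP /(_ (@Ordinal 3 2 isT)) /forallP /(_ (@Ordinal 3 0 isT)).
by rewrite /= ltnS => /eqP e; exists i, j, k.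
Qed.

End Patterns.

(** * Cycle maxima and positions of letters in [theta_word] *)

Section CycleMax.

Variables (n : nat) (s : 'S_n).

Definition cycle_max (x : 'I_n) : 'I_n :=
  [arg max_(j > x in porbit s x) nat_of_ord j].

Lemma cycle_max_in (x : 'I_n) : cycle_max x \in porbit s x.
Proof. by rewrite /cycle_max; case: arg_maxnP => //; apply: porbit_id. Qed.

Lemma leq_cycle_max (x y : 'I_n) : y \in porbit s x -> y <= cycle_max x.
Proof.
rewrite /cycle_max; case: arg_maxnP => [|m _ mmax]; first exact: porbit_id.
exact: mmax.
Qed.

Lemma leq_cycle_max_id (x : 'I_n) : x <= cycle_max x.
Proof. exact/leq_cycle_max/porbit_id. Qed.

Lemma cycle_max_eq (x y : 'I_n) : y \in porbit s x -> cycle_max y = cycle_max x.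
Proof.
rewrite -eq_porbit_mem => /eqP e; apply/val_inj/eqP; rewrite /= eqn_leq.
apply/andP; split; apply: leq_cycle_max; last by rewrite e cycle_max_in.
by rewrite -e cycle_max_in.
Qed.

Lemma perm_in_porbit (x : 'I_n) : s x \in porbit s x.
Proof. by have := mem_porbit s 1 x; rewrite expg1. Qed.

Lemma cycle_max_perm (x : 'I_n) : cycle_max (s x) = cycle_max x.
Proof. exact/cycle_max_eq/perm_in_porbit. Qed.

Lemma cycle_max_max (x : 'I_n) : cycle_max (cycle_max x) = cycle_max x.
Proof. exact/cycle_max_eq/cycle_max_in. Qed.

Lemma porbit_ind (P : 'I_n -> Prop) (x y : 'I_n) :
  (forall z, P z -> P (s z)) -> P x -> y \in porbit s x -> P y.
Proof.
move=> Ps Px /porbitP[i ->]; rewrite permX.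
by elim: i => //= i IH; apply: Ps.
Qed.

Lemma cycle_max_in_porbit (x y : 'I_n) :
  cycle_max x = cycle_max y -> x \in porbit s y.
Proof.
move=> e; have := cycle_max_in x; rewrite e -eq_porbit_mem => /eqP.
have := cycle_max_in y; rewrite -eq_porbit_mem => /eqP -> ->.
exact: porbit_id.
Qed.

Lemma mem_cycle_maxima (m : 'I_n) : (m \in cycle_maxima s) = (cycle_max m == m).
Proof.
rewrite mem_filter mem_enum andbT; apply/forall_inP/eqP => [mmax|e j /leq_cycle_max]; last by rewrite e.
apply/val_inj/eqP; rewrite /= eqn_leq leq_cycle_max_id andbT.
exact/mmax/cycle_max_in.
Qed.

Lemma mem_cycle_from (m x : 'I_n) : (x \in cycle_from s m) = (x \in porbit s m).
Proof. by rewrite porbit_traject. Qed.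

(** Cycles are listed by increasing maximum, so the prefix [u] consists of the cycles with maximum
    below [m]. *)
Lemma theta_word_split (m : 'I_n) : cycle_max m = m ->
  exists u v, theta_word s = u ++ cycle_from s m ++ v /\
    forall x, (x \in u) = (cycle_max x < m).
Proof.
move=> maxm.
have : sorted (fun x y : 'I_n => x < y) (cycle_maxima s).
  apply: sorted_filter; first exact: ltn_ord_trans.
  exact: enum_ord_sorted.
have mem := mem_cycle_maxima; rewrite /theta_word /standard_cycles.
have : m \in cycle_maxima s by rewrite mem maxm.
move: mem => /[swap]; case/splitPr => p q mem.
rewrite sorted_pairwise; last exact: ltn_ord_trans.
rewrite pairwise_cat /= => /and3P[/allrelP lt_p _ /andP[/allP lt_q _]].
exists (flatten (map (cycle_from s) p)), (flatten (map (cycle_from s) q)).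
split=> [|x]; first by rewrite map_cat flatten_cat.
apply/flatten_mapP/idP => [[y yp]|lt_xm].
  rewrite mem_cycle_from => /cycle_max_eq ->.
  have := mem y; rewrite mem_cat yp => /esym/eqP ->.
  by apply: lt_p; rewrite ?mem_head.
exists (cycle_max x); last first.
  by rewrite mem_cycle_from cycle_max_in_porbit // cycle_max_max.
have := mem (cycle_max x); rewrite cycle_max_max eqxx mem_cat inE.
by case/or3P=> [//|/eqP e|/lt_q /=]; [rewrite e ltnn in lt_xm | lia].
Qed.

(** The inverse of [theta s], with values in [nat] for arithmetic. *)
Definition pos (x : 'I_n) : nat := index x (theta_word s).

Lemma pos_lt (x : 'I_n) : pos x < n.
Proof. by rewrite -[X in _ < X](size_theta_word s) index_mem mem_theta_word. Qed.

Lemma theta_pos (x : 'I_n) : theta s (Ordinal (pos_lt x)) = x.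
Proof. by rewrite permE /= nth_index // mem_theta_word. Qed.

Lemma pos_theta (i : 'I_n) : pos (theta s i) = i.
Proof. by rewrite permE /pos index_uniq ?theta_word_uniq // size_theta_word. Qed.

Lemma theta_eq (i x : 'I_n) : (i : nat) = pos x -> theta s i = x.
Proof. by move=> e; rewrite -[RHS]theta_pos; congr (theta s _); apply: val_inj. Qed.

Lemma pos_inj : injective pos.
Proof.
move=> x y e; rewrite -[x]theta_pos -[y]theta_pos.
by congr (theta s _); apply: val_inj.
Qed.

Lemma pos_card (y : 'I_n) : pos y = #|[set x | pos x < pos y]|.
Proof.
rewrite -[LHS](card_ord_lt (ltnW (pos_lt y))).
rewrite -[LHS](card_imset _ (@perm_inj _ (theta s))).
apply: eq_card => x; rewrite inE; apply/imsetP/idP => [[i + ->]|lt_xy].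
  by rewrite inE pos_theta.
by exists (Ordinal (pos_lt x)); rewrite ?inE ?theta_pos.
Qed.

Lemma ltn_pos_cycle_max (x y : 'I_n) : cycle_max x < cycle_max y -> pos x < pos y.
Proof.
move=> lt_xy; have [u [v [e mem_u]]] := theta_word_split (cycle_max_max y).
rewrite /pos e !index_cat !mem_u lt_xy ltnn.
by apply: (leq_trans (n := size u)); rewrite ?leq_addr // index_mem mem_u.
Qed.

(** A cycle fills a block of consecutive positions, from its maximum onwards in the order of
    iteration. *)
Lemma pos_iter (m : 'I_n) : cycle_max m = m ->
  exists p, forall j, j < #|porbit s m| -> pos (iter j s m) = p + j.
Proof.
move=> maxm; have [u [v [e mem_u]]] := theta_word_split maxm.
exists (size u) => j lt_j.
have jm : iter j s m \in porbit s m by rewrite -permX mem_porbit.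
rewrite /pos e !index_cat mem_u (cycle_max_eq jm) maxm ltnn mem_cycle_from jm.
congr (_ + _); rewrite -(nth_traject s lt_j) index_uniq ?size_traject //.
exact: uniq_traject_porbit.
Qed.

Lemma cycle_max_iter (x : 'I_n) :
  exists2 j, j < #|porbit s (cycle_max x)| & x = iter j s (cycle_max x).
Proof.
have : x \in porbit s (cycle_max x).
  by rewrite cycle_max_in_porbit // cycle_max_max.
rewrite porbit_traject => /trajectP[j lt_j e].
by exists j.
Qed.

Lemma pos_cycle_max (x : 'I_n) : x != cycle_max x -> pos (cycle_max x) < pos x.
Proof.
have [p posE] := pos_iter (cycle_max_max x).
have [[|j] lt_j /= {1 4}->] := cycle_max_iter x; first by rewrite eqxx.
move=> _; rewrite -[s _]/(iter j.+1 s _) posE // (posE 0); lia.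
Qed.

Lemma pos_perm (x : 'I_n) : s x != cycle_max x -> pos (s x) = (pos x).+1.
Proof.
have [p posE] := pos_iter (cycle_max_max x).
have [j lt_j {1 3 4}->] := cycle_max_iter x.
rewrite -[s (iter _ _ _)]/(iter j.+1 s _) => neq.
rewrite !posE ?addnS // ltn_neqAle lt_j andbT.
by apply: contra neq => /eqP ->; rewrite iter_porbit.
Qed.

Lemma pos_last (x z : 'I_n) :
  s z = cycle_max z -> cycle_max x = cycle_max z -> pos x <= pos z.
Proof.
move=> sz xz.
have [p posE] := pos_iter (cycle_max_max z).
have [j lt_j ez] := cycle_max_iter z.
have [i lt_i ex] := cycle_max_iter x; rewrite xz in lt_i ex.
rewrite {1}ex {2}ez !posE // leq_add2l.
(* Otherwise the iterate after [z], which is the maximum again, would have both positions [p] and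
   [p + j.+1]. *)
have : ~~ (j.+1 < #|porbit s (cycle_max z)|); last lia.
apply/negP => lt_j1.
have := posE _ lt_j1; rewrite /= -ez sz => e0.
by have /= := posE 0 (leq_ltn_trans (leq0n _) lt_j); rewrite e0; lia.
Qed.

End CycleMax.

(** * Patterns in [theta s], stable initial segments and near-fixed points *)

Section Theta.

Variables (n : nat) (s : 'S_n).

Lemma avoids_theta231 (x y z : 'I_n) :
  avoids (theta s) [:: 2; 3; 1] -> pos s x < pos s y -> pos s y < pos s z ->
  x < y -> z < x -> False.
Proof.
move=> av xy yz; have := avoids231 av (i := Ordinal (pos_lt s x))
  (j := Ordinal (pos_lt s y)) (k := Ordinal (pos_lt s z)) xy yz.
by rewrite !theta_pos.
Qed.

Lemma avoids_theta312 (x y z : 'I_n) :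
  avoids (theta s) [:: 3; 1; 2] -> pos s x < pos s y -> pos s y < pos s z ->
  y < z -> z < x -> False.
Proof.
move=> av xy yz; have := avoids312 av (i := Ordinal (pos_lt s x))
  (j := Ordinal (pos_lt s y)) (k := Ordinal (pos_lt s z)) xy yz.
by rewrite !theta_pos.
Qed.

Lemma avoids_theta321 (x y z : 'I_n) :
  avoids (theta s) [:: 3; 2; 1] -> pos s x < pos s y -> pos s y < pos s z ->
  y < x -> z < y -> False.
Proof.
move=> av xy yz; have := avoids321 av (i := Ordinal (pos_lt s x))
  (j := Ordinal (pos_lt s y)) (k := Ordinal (pos_lt s z)) xy yz.
by rewrite !theta_pos.
Qed.

(** A maximum opens its cycle, so exactly the letters of earlier cycles precede it. *)
Lemma pos_max_card (m : 'I_n) : cycle_max s m = m ->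
  pos s m = #|[set x | cycle_max s x < m]|.
Proof.
move=> maxm; rewrite pos_card; apply: eq_card => x; rewrite !inE.
apply/idP/idP => [lt_xm|lt_xm]; last by apply: ltn_pos_cycle_max; rewrite maxm.
rewrite ltnNge leq_eqVlt; apply/negP => /orP[/eqP/val_inj e|lt_mx].
  have [e1|neq] := eqVneq x (cycle_max s x); first by rewrite e -e1 ltnn in lt_xm.
  by have := pos_cycle_max neq; rewrite -e; lia.
suff: pos s m < pos s x by lia.
by apply: ltn_pos_cycle_max; rewrite maxm.
Qed.

Lemma pos_gt_cycle_max (m x : 'I_n) :
  cycle_max s x = m -> x != m -> pos s m < pos s x.
Proof. by move=> <-; apply: pos_cycle_max. Qed.

Lemma pos_lt_last (m x z : 'I_n) :
  s z = m -> cycle_max s z = m -> cycle_max s x = m -> x != z ->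
  pos s x < pos s z.
Proof.
move=> sz maxz maxx neq; rewrite ltn_neqAle pos_last ?maxz // andbT.
by apply: contra neq => /eqP/pos_inj ->.
Qed.

Section Initial.

Variables (N : 'I_n) (closedN : forall x : 'I_n, x <= N -> s x <= N).

Lemma cycle_max_initial (x : 'I_n) : x <= N -> cycle_max s x <= N.
Proof.
move=> le_xN; move: (cycle_max_in s x).
exact: (porbit_ind (P := fun y : 'I_n => y <= N)).
Qed.

Lemma cycle_max_initial_max : cycle_max s N = N.
Proof.
by apply/val_inj/eqP; rewrite /= eqn_leq leq_cycle_max_id cycle_max_initial.
Qed.

(** A letter above [N] comes after all [N + 1] letters of the stable segment, hence at a position
    above [N]. *)
Lemma theta_initial (x : 'I_n) : x <= N -> theta s x <= N.
Proof.
move=> le_xN; rewrite leqNgt; apply/negP => lt_N.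
have /subset_leq_card :
    [set y : 'I_n | y < N.+1] \subset [set y | pos s y < pos s (theta s x)].
  apply/subsetP => y; rewrite !inE ltnS => le_yN; apply: ltn_pos_cycle_max.
  apply: leq_ltn_trans (cycle_max_initial le_yN) _.
  exact: leq_trans lt_N (leq_cycle_max_id s _).
by rewrite -pos_card pos_theta card_ord_lt //; lia.
Qed.

(** The cycle of [N] is the last one inside the stable segment, so position [N] holds its final
    letter, the preimage of [N]. *)
Lemma perm_theta_initial : s (theta s N) = N.
Proof.
pose z := (s^-1)%g N; have sz : s z = N by rewrite permKV.
have maxz : cycle_max s z = N by rewrite -cycle_max_perm sz cycle_max_initial_max.
have le_zN : z <= N by rewrite -maxz leq_cycle_max_id.
rewrite (_ : theta s N = z) //; apply: theta_eq; rewrite pos_card.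
have -> : [set x | pos s x < pos s z] = [set x : 'I_n | x < N.+1] :\ z.
  apply/setP => x; rewrite !inE ltnS; have [->|neq] /= := eqVneq x z.
    by rewrite ltnn.
  have [le_xN|lt_Nx] := leqP x N.
    have := cycle_max_initial le_xN; rewrite leq_eqVlt.
    case/orP=> [/eqP/val_inj maxx|lt_max]; first exact: (@pos_lt_last N).
    by apply: ltn_pos_cycle_max; rewrite maxz.
  apply/negbTE; rewrite -leqNgt; apply/ltnW/ltn_pos_cycle_max; rewrite maxz.
  exact: leq_trans lt_Nx (leq_cycle_max_id s _).
have := cardsD1 z [set x : 'I_n | x < N.+1].
by rewrite card_ord_lt // inE ltnS le_zN add1n => -[].
Qed.

End Initial.

Definition near_fixed (i : 'I_n) : bool :=
  [&& s (s i) == i, s i <= i.+1 & i <= (s i).+1].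

Lemma near_fixed_perm (i : 'I_n) : near_fixed (s i) = near_fixed i.
Proof.
rewrite /near_fixed (inj_eq perm_inj); case: eqP => //= ->.
by rewrite andbC.
Qed.

(** A point sent above [N] has a near-fixed image, so it is near-fixed itself and differs from [N];
    but from below [N] it moves up by at most one. *)
Lemma near_fixed_initial (N : 'I_n) :
  ~~ near_fixed N -> (forall x : 'I_n, N < x -> near_fixed x) ->
  forall x : 'I_n, x <= N -> s x <= N.
Proof.
move=> badN good x le_xN; rewrite leqNgt; apply/negP => lt_N.
have := good _ lt_N; rewrite near_fixed_perm => goodx.
have neq : (x : nat) <> N by move/val_inj => e; rewrite -e goodx in badN.
by case/and3P: goodx => _; lia.
Qed.

End Theta.

(** * The patterns 312 and 231: the largest point that is not near-fixed *)

Section Max.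

Variables (n : nat) (s : 'S_n) (N : 'I_n).
Hypothesis badN : ~~ near_fixed s N.
Hypothesis good : forall x : 'I_n, N < x -> near_fixed s x.

Let closed := near_fixed_initial badN good.
Let maxN : cycle_max s N = N := cycle_max_initial_max closed.

Lemma bad_max_lt : s N < N.
Proof.
rewrite ltn_neqAle closed // andbT; apply: contra badN => /eqP/val_inj e.
by rewrite /near_fixed !e eqxx; lia.
Qed.

Lemma avoids312_no_bad_max :
  avoids s [:: 3; 1; 2] -> avoids (theta s) [:: 3; 1; 2] ->
  avoids (theta (theta s)) [:: 3; 1; 2] -> False.
Proof.
move=> av0 av1 av2.
have closed1 := theta_initial closed.
have sz := perm_theta_initial closed; set z := theta s N in sz.
have lt_cN := bad_max_lt; set c := s N in lt_cN.
have maxc : cycle_max s c = N by rewrite cycle_max_perm.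
have maxz : cycle_max s z = N by rewrite -cycle_max_perm sz.
have neq_cN : c != N by rewrite -val_eqE /=; lia.
have posNc : pos s N < pos s c by apply: pos_gt_cycle_max.
(* If [z] and [c] differ, 312-avoidance of the word for [N, c, z] and for [N, c, s c] gives [z < c]
   and [s c < c]; then [s] has the 312 [N, s c, c] at positions [z < c < N]. *)
have [ezc|neq_zc] := eqVneq z c; last first.
  have poscz : pos s c < pos s z.
    by apply: (@pos_lt_last _ s N); rewrite // eq_sym.
  have lt_zN : z < N.
    rewrite ltn_neqAle -{2}maxz leq_cycle_max_id andbT val_eqE.
    by apply: contra neq_cN => /eqP e; rewrite /c -e sz e.
  have lt_zc : z < c.
    rewrite ltn_neqAle val_eqE neq_zc /= leqNgt; apply/negP => lt_cz.
    by apply: (avoids_theta312 av1 posNc poscz); lia.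
  have neq_sc : s c != N by rewrite -sz (inj_eq perm_inj) eq_sym.
  have lt_scN : s c < N by rewrite ltn_neqAle val_eqE neq_sc closed // ltnW.
  have posc : pos s c < pos s (s c) by rewrite pos_perm ?maxc.
  have neq_scc : s c != c by rewrite /c (inj_eq perm_inj).
  have lt_scc : s c < c.
    rewrite ltn_neqAle val_eqE neq_scc /= leqNgt; apply/negP => lt_csc.
    by apply: (avoids_theta312 av1 posNc posc); lia.
  by apply: (avoids312 av0 lt_zc lt_cN); rewrite -/c ?sz; lia.
(* Now [s] swaps [N] and [c], and the word ends this cycle at position [N], so [N] itself sits at
   position [y = N - 1]. *)
have posc : pos s c = N by rewrite -ezc pos_theta.
have : pos s c = (pos s N).+1 by rewrite pos_perm // maxN.
rewrite {}posc; set y := Ordinal (pos_lt s N) => ey.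
have ey' : (y : nat).+1 = N by rewrite ey.
have ty : theta s y = N by rewrite theta_pos.
have max1N : cycle_max (theta s) N = N by apply: cycle_max_initial_max.
have max1c : cycle_max (theta s) c = N by rewrite -ezc cycle_max_perm.
have max1y : cycle_max (theta s) y = N by rewrite -cycle_max_perm ty.
(* If [c] were [N - 1], [s] would swap neighbours and [N] would be near-fixed. *)
have lt_cy : c < y.
  rewrite ltn_neqAle; apply/andP; split; last lia.
  apply: contra badN => /eqP/val_inj e.
  by rewrite /near_fixed -/c -{1}ezc sz eqxx e; lia.
have p1 : pos (theta s) N < pos (theta s) c by apply: pos_gt_cycle_max.
have p2 : pos (theta s) c < pos (theta s) y.
  by apply: (@pos_lt_last _ (theta s) N); rewrite // -val_eqE /=; lia.
by apply: (avoids_theta312 av2 p1 p2); lia.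
Qed.

Lemma avoids231_no_bad_max :
  avoids s [:: 2; 3; 1] -> avoids (theta s) [:: 2; 3; 1] ->
  avoids (theta (theta s)) [:: 2; 3; 1] -> False.
Proof.
move=> av0 av1 av2.
have closed1 := theta_initial closed.
have sz := perm_theta_initial closed; set z := theta s N in sz.
have lt_cN := bad_max_lt.
have maxz : cycle_max s z = N by rewrite -cycle_max_perm sz.
have neq_zN : z != N.
  by apply/eqP => e; move: sz lt_cN; rewrite e => ->; rewrite ltnn.
have lt_zN : z < N by rewrite ltn_neqAle -{2}maxz leq_cycle_max_id andbT val_eqE.
have closedz (x : 'I_n) : x < z -> s x < z.
  (* Values left of the maximum are smaller than the values right of it. *)
  move=> lt_xz; rewrite ltnNge; apply/negP => le_zsx.
  (* Pigeonhole: the points below [z] do not map onto themselves, so some value below [z] is taken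
     elsewhere. Positions [x < z < k] then carry the 231 [s x, N, s k]. *)
  have [k le_zk lt_skz] : exists2 k : 'I_n, z <= k & s k < z.
    have : ~~ ([set y : 'I_n | y < z] \subset s @: [set y : 'I_n | y < z]).
      apply/negP => sub.
      have : [set y : 'I_n | y < z] == s @: [set y : 'I_n | y < z].
        by rewrite eqEcard sub card_imset ?leqnn //; apply: perm_inj.
      move/eqP/setP => /(_ (s x)).
      by rewrite inE ltnNge le_zsx imset_f // inE.
    case/subsetPn => y; rewrite inE => lt_yz notin.
    exists ((s^-1)%g y); last by rewrite permKV.
    rewrite leqNgt; apply: contra notin => lt_y.
    by apply/imsetP; exists ((s^-1)%g y); rewrite ?inE // permKV.
  have neq_kz : (k : nat) <> z by move/val_inj => e; rewrite e sz in lt_skz; lia.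
  have lt_zk : z < k by lia.
  have le_sxN : s x <= N by apply: closed; lia.
  have neq_sx : (s x : nat) <> N.
    by rewrite -sz => /val_inj/perm_inj e; rewrite e ltnn in lt_xz.
  by apply: (avoids231 av0 lt_xz lt_zk); rewrite ?sz; lia.
(* The letters before [N] are exactly those below [z]: a larger one would form a 231 with [N] and
   [z], and conversely the points below [z] form whole cycles. *)
have posN : pos s N = z.
  rewrite pos_max_card // -[RHS](card_ord_lt (ltnW (ltn_ord z))).
  apply: eq_card => x; rewrite !inE; apply/idP/idP => [lt_max|lt_xz].
    have p1 : pos s x < pos s N by apply: ltn_pos_cycle_max; rewrite maxN.
    have p2 : pos s N < pos s z by apply: pos_gt_cycle_max.
    have := leq_cycle_max_id s x.
    have neq : (x : nat) <> z by move/val_inj => e; rewrite e maxz ltnn in lt_max.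
    move=> le_x; rewrite ltnNge; apply/negP => le_zx.
    by apply: (avoids_theta231 av1 p1 p2); lia.
  apply: ltn_trans lt_zN.
  by apply: (porbit_ind (P := fun y : 'I_n => y < z) _ lt_xz (cycle_max_in s x)).
have tz : theta s z = N by apply: theta_eq.
have max1N : cycle_max (theta s) N = N by apply: cycle_max_initial_max.
have max1z : cycle_max (theta s) z = N by rewrite cycle_max_perm.
have p2 : pos (theta s) N < pos (theta s) z by apply: pos_gt_cycle_max.
(* Otherwise [w = z + 1] lies outside the 2-cycle of [N] and [z] in [theta s], so its cycle is
   listed earlier. *)
have adj : (z : nat).+1 = N.
  apply/eqP; rewrite eqn_leq lt_zN leqNgt; apply/negP => lt_z1.
  pose w := Ordinal (ltn_trans lt_z1 (ltn_ord N)).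
  have maxw : cycle_max (theta s) w < N.
    rewrite ltn_neqAle (@cycle_max_initial _ _ N closed1 w lt_zN) andbT.
    apply/negP => /eqP/val_inj e.
    have win : w \in porbit (theta s) N by apply: cycle_max_in_porbit; rewrite e.
    have [] : w = N \/ w = z.
      apply: (porbit_ind (P := fun y => y = N \/ y = z) _ _ win); last by left.
      by move=> y [] ->; rewrite ?tz -/z; [right | left].
    + by move/(congr1 val) => /=; lia.
    + by move/(congr1 val) => /=; lia.
  have p1 : pos (theta s) w < pos (theta s) N.
    by apply: ltn_pos_cycle_max; rewrite max1N.
  by apply: (avoids_theta231 av2 p1 p2) => /=; lia.
(* With [z = N - 1] only [s N < z] remains to be excluded: the orbit of [s N] would then stay below
   [z], although it contains [N]. *)
suff sN : s N = z by move: badN; rewrite /near_fixed sN sz eqxx; lia.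
apply/val_inj => /=.
suff : z <= s N by lia.
rewrite leqNgt; apply/negP => lt_sNz.
have : N < z; last lia.
apply: (porbit_ind (P := fun y : 'I_n => y < z) closedz lt_sNz).
by rewrite porbit_sym perm_in_porbit.
Qed.

End Max.

(** * The pattern 321: the smallest cycle maximum that is not near-fixed *)

Section Avoid321.

Variables (n : nat) (s : 'S_n).

Lemma near_fixed_cycle_max (x : 'I_n) :
  near_fixed s (cycle_max s x) = near_fixed s x.
Proof.
apply: (porbit_ind (P := fun y => near_fixed s y = near_fixed s x) _ _
  (cycle_max_in s x)) => //.
by move=> y <-; rewrite near_fixed_perm.
Qed.

Lemma avoids321_near_fixed (x : 'I_n) :
  avoids s [:: 3; 2; 1] -> avoids (theta s) [:: 3; 2; 1] ->
  avoids (theta (theta s)) [:: 3; 2; 1] -> near_fixed s x.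
Proof.
move=> av0 av1 av2; apply/negPn/negP => badx.
pose P y := ~~ near_fixed s y && (cycle_max s y == y).
have Px : P (cycle_max s x) by rewrite /P near_fixed_cycle_max badx cycle_max_max eqxx.
case: (arg_minnP (fun i : 'I_n => i : nat) Px) => M /andP[badM /eqP maxM] minM.
have good y : cycle_max s y < M -> near_fixed s y.
  move=> lt_yM; apply/negPn/negP => bady.
  have : P (cycle_max s y) by rewrite /P near_fixed_cycle_max bady cycle_max_max eqxx.
  by move/minM; rewrite leqNgt lt_yM.
pose a := s M.
have bada : ~~ near_fixed s a by rewrite near_fixed_perm.
have maxa : cycle_max s a = M by rewrite cycle_max_perm.
have neq_aM : a != M.
  by apply: contra badM => /eqP e; rewrite /near_fixed -/a !e -/a !e eqxx; lia.
have lt_aM : a < M by rewrite ltn_neqAle val_eqE neq_aM -maxa leq_cycle_max_id.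
have posa : pos s a = (pos s M).+1 by rewrite pos_perm ?maxM.
(* Otherwise [e] follows [M] and [a] in the word, and [M, a, e] is a 321. *)
have lt_max (e : 'I_n) : e < a -> cycle_max s e < M.
  move=> lt_ea; rewrite ltnNge; apply/negP => le_Me.
  have posMe : pos s M < pos s e.
    move: le_Me; rewrite leq_eqVlt => /orP[/eqP/val_inj e1|lt_Me].
      by apply: pos_gt_cycle_max => //; rewrite -val_eqE /=; lia.
    by apply: ltn_pos_cycle_max; rewrite maxM.
  have neq : pos s a <> pos s e by move/pos_inj => e1; rewrite e1 ltnn in lt_ea.
  have p1 : pos s M < pos s a by lia.
  have p2 : pos s a < pos s e by lia.
  by apply: (avoids_theta321 av1 p1 p2); lia.
have max_lt (f : 'I_n) : cycle_max s f < M -> f < a.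
  move=> lt_fM; rewrite ltnNge; apply/negP => le_af.
  have goodf := good _ lt_fM.
  have neq_max y : cycle_max s y = M -> (y : nat) <> f /\ (s f : nat) <> y.
    move=> maxy; split=> /val_inj e; first by rewrite -e maxy ltnn in lt_fM.
    by rewrite -cycle_max_perm e maxy ltnn in lt_fM.
  have [] := neq_max _ maxa => neq_af neq_sfa.
  have lt_f : f < M := leq_ltn_trans (leq_cycle_max_id s f) lt_fM.
  (* The cycle of M climbs from a < f to M > f, so it jumps over f. *)
  have [/existsP[e /and3P[/eqP maxe lt_ef le_fse]]|none] :=
    boolP [exists e : 'I_n, [&& cycle_max s e == M, e < f & f <= s e]].
    have maxse : cycle_max s (s e) = M by rewrite cycle_max_perm.
    have [neq1 neq2] := neq_max _ maxse.
    case/and3P: goodf => _ lef1 lef2.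
    (* As [s f] is within one of [f] and neither lies in the cycle of [M], [a < s f < s e]: a 321 at
       positions [e < f < M]. *)
    by apply: (avoids321 av0 lt_ef lt_f); rewrite -/a; lia.
  (* Without a jump the orbit of [a] stays below [f], and so does [M]. *)
  suff [_ /(ltn_trans lt_f)] : cycle_max s M = M /\ M < f by rewrite ltnn.
  apply: (porbit_ind (P := fun y : 'I_n => cycle_max s y = M /\ y < f) (s := s) (x := a)).
  - move=> y [maxy lt_yf] /=; rewrite cycle_max_perm; split=> //.
    rewrite ltnNge; apply: contra none => le_f; apply/existsP; exists y.
    by rewrite maxy eqxx lt_yf le_f.
  - by split=> //; lia.
  - by apply: cycle_max_in_porbit; rewrite maxM maxa.
have posM : pos s M = a.
  rewrite pos_max_card // -[RHS](card_ord_lt (ltnW (ltn_ord a))).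
  by apply: eq_card => y; rewrite !inE; apply/idP/idP => [/max_lt|/lt_max].
have ta : theta s a = M by apply: theta_eq.
pose y := Ordinal (pos_lt s a); have ty : theta s y = a by rewrite theta_pos.
have ey : (y : nat) = a.+1 by rewrite /= posa posM.
have max1a : cycle_max (theta s) a = cycle_max (theta s) y.
  by rewrite -ty cycle_max_perm.
have le_yK := leq_cycle_max_id (theta s) y.
(* If [y = a + 1] is not the maximum of its cycle in [theta s], that maximum, [y] and [a] appear in
   this order in the next word, a 321. Otherwise [M], in the same cycle, is at most [a + 1]. *)
have [eyK|neq_yK] := eqVneq y (cycle_max (theta s) y); last first.
  have p1 := pos_cycle_max neq_yK.
  have p2 : pos (theta s) y < pos (theta s) a.
    by rewrite -ty pos_perm // ty -val_eqE /=; lia.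
  have neq : (y : nat) <> cycle_max (theta s) y.
    by move/val_inj => e; rewrite -e eqxx in neq_yK.
  by apply: (avoids_theta321 av2 p1 p2); lia.
have le_My : M <= y.
  by rewrite eyK -max1a -cycle_max_perm ta leq_cycle_max_id.
have maxsa : cycle_max s (s a) = M by rewrite cycle_max_perm.
(* [s a] is at most [M = a + 1], is not below [a] since such points lie in earlier cycles, and is
   not [a]. *)
have sa : s a = M.
  apply: val_inj => /=; have := leq_cycle_max_id s (s a); rewrite maxsa.
  have : ~~ (s a < a) by apply/negP => /lt_max; rewrite maxsa ltnn.
  have : (s a : nat) <> a.
    by move/val_inj; rewrite {2}/a => /perm_inj e; rewrite e eqxx in neq_aM.
  by lia.
by move: badM; rewrite /near_fixed -/a sa eqxx; lia.
Qed.

End Avoid321.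

(** * Near-fixed permutations are fixed by [theta] and avoid the patterns *)

Section NearFixed.

Variables (n : nat) (s : 'S_n).
Hypothesis good : forall i, near_fixed s i.

Lemma near_fixedK (x : 'I_n) : s (s x) = x.
Proof. by case/and3P: (good x) => /eqP. Qed.

Lemma near_fixed_cycle_maxE (x : 'I_n) :
  cycle_max s x = maxn x (s x) :> nat.
Proof.
apply/eqP; rewrite eqn_leq; apply/andP; split.
  have [->|->] : cycle_max s x = x \/ cycle_max s x = s x; [|lia|lia].
  apply: (porbit_ind (P := fun y => y = x \/ y = s x) _ _ (cycle_max_in s x)).
    by move=> y [->|->]; [right|left; rewrite near_fixedK].
  by left.
by rewrite geq_max leq_cycle_max_id leq_cycle_max // perm_in_porbit.
Qed.

Lemma near_fixed_pos (x : 'I_n) : pos s x = s x.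
Proof.
(* For the top of a cycle, the earlier cycles contain exactly the letters below [s y]; a lower point
   follows its top directly. *)
have pos_top (y : 'I_n) : s y <= y -> pos s y = s y.
  move=> le_sy; rewrite pos_max_card; last first.
    by apply/val_inj; rewrite /= near_fixed_cycle_maxE; lia.
  rewrite -[RHS](card_ord_lt (ltnW (ltn_ord (s y)))); apply: eq_card => z.
  rewrite !inE near_fixed_cycle_maxE.
  have neq1 : (s z : nat) = y -> (z : nat) = s y.
    by move/val_inj => <-; rewrite near_fixedK.
  have neq2 : (z : nat) = s y -> (s z : nat) = y.
    by move/val_inj => ->; rewrite near_fixedK.
  case/and3P: (good y) => _ _ le_y; case/and3P: (good z) => _ le_z _.
  by apply/idP/idP => ?; lia.
have [/pos_top //|lt_x] := leqP (s x) x.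
have le_x : s (s x) <= s x by rewrite near_fixedK ltnW.
have maxsx : cycle_max s (s x) = s x.
  by apply/val_inj; rewrite /= near_fixed_cycle_maxE; lia.
rewrite -{1}[x]near_fixedK pos_perm; last first.
  by rewrite near_fixedK maxsx -val_eqE /=; lia.
rewrite pos_top // near_fixedK; case/and3P: (good x) => _; lia.
Qed.

Lemma near_fixed_theta : theta s = s.
Proof. by apply/permP => i; apply: theta_eq; rewrite near_fixed_pos near_fixedK. Qed.

(** Positions [i < j < k] are two apart at the ends, so [s i <= i + 1 <= k - 1 <= s k]. *)
Lemma near_fixed_avoids (a b c : nat) : c < a -> avoids s [:: a; b; c].
Proof.
move=> lt_ca; apply/negP => /contains3[i [j [k [ij jk]]]]; rewrite lt_ca.
by case/and3P: (good i) => _ ? _; case/and3P: (good k) => _ _ ?; lia.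
Qed.

End NearFixed.

Lemma avoids_near_fixed (n : nat) (s : 'S_n) (sigma : seq nat) :
  sigma \in [:: [:: 2; 3; 1]; [:: 3; 1; 2]; [:: 3; 2; 1]] ->
  avoids s sigma -> avoids (theta s) sigma -> avoids (theta (theta s)) sigma ->
  forall i, near_fixed s i.
Proof.
move=> hsigma av0 av1 av2 i; apply/negPn/negP => bad.
case: (arg_maxnP (P := fun y => ~~ near_fixed s y) (fun i : 'I_n => i : nat) bad).
move=> N badN maxN.
have good (x : 'I_n) : N < x -> near_fixed s x.
  by move=> lt_Nx; apply/negPn/negP => /maxN; lia.
move: hsigma; rewrite !inE => /or3P[] /eqP e; rewrite {}e in av0 av1 av2.
- exact: (avoids231_no_bad_max badN good av0 av1 av2).
- exact: (avoids312_no_bad_max badN good av0 av1 av2).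
- by move: badN; rewrite avoids321_near_fixed.
Qed.

(** * Counting near-fixed permutations by the Fibonacci recursion *)

(** Stated on [nat] so that dropping the last one or two points does not change the type of [f]. *)
Definition near_fun (n : nat) (f : nat -> nat) : Prop :=
  forall i, i < n -> [/\ f i < n, f (f i) = i, f i <= i.+1 & i <= (f i).+1].

Lemma near_fun_ext (n : nat) (f g : nat -> nat) :
  (forall i, i < n -> f i = g i) -> near_fun n f -> near_fun n g.
Proof.
move=> e nf i lt_in; have [lt_f ff le1 le2] := nf _ lt_in.
by rewrite -!(e i) // -(e (f i)).
Qed.

Lemma near_funSS (n : nat) (f : nat -> nat) :
  near_fun n.+2 f <->
  (f n.+1 = n.+1 /\ near_fun n.+1 f) \/
  [/\ f n.+1 = n, f n = n.+1 & near_fun n f].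
Proof.
split=> [nf|[[fn nf]|[fn1 fn nf]] i lt_i].
- have [lt_f ff _ le] := nf _ (ltnSn n.+1).
  have [fn|fn] : f n.+1 = n.+1 \/ f n.+1 = n by lia.
  + left; split=> // i lt_i; have [//|lt_fi ffi le1 le2] := nf i; first by lia.
    split=> //; have : f i <> n.+1 by move=> e; rewrite e fn in ffi; lia.
    by lia.
  + rewrite fn in ff; right; split=> // i lt_i.
    have [|lt_fi ffi le1 le2] := nf i; first by lia.
    split=> //; have : f i <> n.+1 by move=> e; rewrite e fn in ffi; lia.
    have : f i <> n by move=> e; rewrite e ff in ffi; lia.
    by lia.
- have [->|lt_i1] : i = n.+1 \/ i < n.+1 by lia.
    by rewrite !fn; split; lia.
  by have [] := nf _ lt_i1; split; lia.
- have [->|[->|lt_i1]] : i = n.+1 \/ i = n \/ i < n by lia.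
  + by rewrite fn1 fn; split; lia.
  + by rewrite fn fn1; split; lia.
  + by have [] := nf _ lt_i1; split; lia.
Qed.

(** One-line words with letters from 0: the last point is either fixed or swapped with its
    neighbour, which mirrors the recursion of [fib]. *)
Fixpoint near_words (n : nat) : seq (seq nat) :=
  match n with
  | 0 => [:: [::]]
  | 1 => [:: [:: 0]]
  | (m.+1 as m1).+1 =>
      [seq rcons w m1 | w <- near_words m1] ++
      [seq w ++ [:: m1; m] | w <- near_words m]
  end.

Lemma near_wordsSS (n : nat) : near_words n.+2 =
  [seq rcons w n.+1 | w <- near_words n.+1] ++
  [seq w ++ [:: n.+1; n] | w <- near_words n].
Proof. by []. Qed.

Lemma size_near_words (n : nat) : size (near_words n) = fib n.+1.
Proof.
suff : size (near_words n) = fib n.+1 /\ size (near_words n.+1) = fib n.+2 by case.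
elim: n => // n [IH1 IH2]; split=> //.
by rewrite near_wordsSS size_cat !size_map IH1 IH2.
Qed.

Lemma near_words_uniq (n : nat) : uniq (near_words n).
Proof.
suff : uniq (near_words n) /\ uniq (near_words n.+1) by case.
elim: n => // n [IH1 IH2]; split=> //.
rewrite near_wordsSS cat_uniq map_inj_uniq ?IH2; last exact: rcons_injl.
rewrite map_inj_uniq ?IH1 ?andbT; last first.
  move=> w1 w2 e; have := congr1 (take (size w1)) e.
  rewrite !take_size_cat //.
  by have := congr1 size e; rewrite !size_cat /=; lia.
(* The last letter, [n] or [n.+1], separates the two halves. *)
apply/hasPn => _ /mapP[w _ ->]; apply/negP => /mapP[w' _ e].
by have := congr1 (last 0) e; rewrite last_rcons last_cat /=; lia.
Qed.

Lemma near_wordsP (n : nat) (w : seq nat) :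
  w \in near_words n <-> size w = n /\ near_fun n (nth 0 w).
Proof.
suff [] : (forall w, w \in near_words n <-> size w = n /\ near_fun n (nth 0 w)) /\
    (forall w, w \in near_words n.+1 <-> size w = n.+1 /\ near_fun n.+1 (nth 0 w)).
  by move=> + _; apply.
elim: n {w} => [|n [IH1 IH2]]; split=> // w.
- rewrite inE; split=> [/eqP ->|[/size0nil -> //]].
  by split=> //.
- rewrite inE; split=> [/eqP ->|]; first by split=> // -[].
  case: w => [|x [|y w]] [] // _ nf.
  by have [/= lt_x _ _ _] := nf 0 isT; have -> : x = 0 by lia.
rewrite near_wordsSS mem_cat near_funSS; split.
  case/orP=> /mapP[v] => [/IH2|/IH1] [sz nf] ->.
    split; first by rewrite size_rcons sz.
    left; split; first by rewrite nth_rcons sz ltnn eqxx.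
    by apply: near_fun_ext nf => i lt_i; rewrite nth_rcons sz lt_i.
  split; first by rewrite size_cat sz /= addn2.
  right; split.
  + by rewrite nth_cat sz ltnNge leqnSn /= subSn // subnn.
  + by rewrite nth_cat sz ltnn subnn.
  + by apply: near_fun_ext nf => i lt_i; rewrite nth_cat sz lt_i.
case=> sz [[wn nf]|[wn1 wn nf]]; apply/orP; [left|right]; apply/mapP.
  exists (take n.+1 w).
    apply/IH2; split; first by rewrite size_take sz leqnn.
    by apply: near_fun_ext nf => i lt_i; rewrite nth_take.
  by rewrite -{2}wn -take_nth ?sz // take_oversize ?sz.
exists (take n w).
  apply/IH1; split; first by rewrite size_take sz; case: ifP => //; lia.
  by apply: near_fun_ext nf => i lt_i; rewrite nth_take.
rewrite -{1}[w](cat_take_drop n); congr (_ ++ _).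
rewrite (drop_nth 0) ?sz // (drop_nth 0) ?sz // wn wn1.
by rewrite drop_oversize ?sz.
Qed.

Lemma card_near_fixed (n : nat) :
  #|[set s : 'S_n | [forall i, near_fixed s i]]| = fib n.+1.
Proof.
pose word (s : 'S_n) := [seq val (s i) | i <- enum 'I_n].
have nth_word s (i : 'I_n) : nth 0 (word s) i = s i.
  by rewrite (nth_map i) ?size_enum_ord // nth_ord_enum.
have word_inj : injective word.
  move=> s t e; apply/permP => i; apply: val_inj.
  by rewrite /= -!nth_word e.
rewrite -size_near_words cardE -(size_map word); apply/perm_size/uniq_perm.
- by rewrite map_inj_uniq // enum_uniq.
- exact: near_words_uniq.
move=> w; apply/mapP/idP => [[s]|/near_wordsP[sz nf]].
  rewrite mem_enum inE => /forallP good ->; apply/near_wordsP.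
  split=> [|i lt_i]; first by rewrite size_map size_enum_ord.
  have /and3P[/eqP ss le1 le2] := good (Ordinal lt_i).
  rewrite -[i]/(nat_of_ord (Ordinal lt_i)) !nth_word ss.
  by split.
have lt_w (i : 'I_n) : nth 0 w i < n by have [] := nf _ (ltn_ord i).
pose f (i : 'I_n) := Ordinal (lt_w i).
have fK i : f (f i) = i by apply: val_inj; have [] := nf _ (ltn_ord i).
(* The word defines an involution, hence a permutation. *)
exists (perm (can_inj fK)).
  rewrite mem_enum inE; apply/forallP => i; rewrite /near_fixed !permE fK eqxx.
  by have [_ _ le1 le2] := nf _ (ltn_ord i); rewrite le1 le2.
apply: (@eq_from_nth _ 0) => [|i]; first by rewrite size_map size_enum_ord.
by rewrite sz => lt_i; rewrite -[i]/(nat_of_ord (Ordinal lt_i)) nth_word permE.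
Qed.

Theorem theorem4p4 (n k : nat) (sigma : seq nat)
    (hn : 1 <= n) (hk : 2 <= k)
    (hsigma : sigma \in [:: [:: 2; 3; 1]; [:: 3; 1; 2]; [:: 3; 2; 1]]) :
  #|[set s : 'S_n | [forall j : 'I_k.+1, avoids (iter j (@theta n) s) sigma]]|
  = fib n.+1.
Proof.
rewrite -card_near_fixed; apply: eq_card => s; rewrite !inE.
apply/forallP/forallP => [av|good j].
  (* Since [2 <= k], the iterates 0, 1 and 2 are among those assumed to avoid [sigma]. *)
  apply: (avoids_near_fixed hsigma).
  - exact: (av ord0).
  - exact: (av (Ordinal (leqW hk : 1 < k.+1))).
  - exact: (av (Ordinal (hk : 2 < k.+1))).
have -> : iter j (@theta n) s = s.
  by elim: (j : nat) => //= i ->; apply: near_fixed_theta.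
by move: hsigma; rewrite !inE => /or3P[] /eqP ->; apply: near_fixed_avoids.
Qed.
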